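(* Let $q$ be an odd positive integer and let $\ell$ be an odd prime dividing $q$. Then the $\ell$-twisted Alexander polynomial of the 2-bridge torus knot $K_{1/q}$ (the $(2,q)$-torus knot) is $$\tilde\Delta^\ell_{1/q}(t)\doteq\frac{\Delta_{K_{1/q}}(t)}{t-1}\left(\frac{(1+t)(1+t^q)^{\frac{\ell-1}{2}}}{1+t^\ell}\right)\left(\frac{(1-t)(1-t^q)^{\frac{\ell-1}{2}}}{1-t^\ell}\right),$$ where $\doteq$ denotes equality up to a factor $\pm t^{r\ell}$, $r\in\mathbb Z$.
   Context: Here $\Delta_{K_{1/q}}(t)=1-t+t^2-\dots+t^{q-1}$. The knot group of $K_{1/q}$ is $G=\langle a,b\mid aw=wb\rangle$ with $w=(ba)^{(q-1)/2}$. The dihedral group is $D_\ell=\langle x,y\mid x^2=1,\ y^\ell=1,\ yx=xy^{-1}\rangle$. Fix $\pi:D_\ell\to GL(\ell,\mathbb C)$ with $\pi(x)=F$, the matrix with ones on the antidiagonal and zeros elsewhere, and $\pi(y)=R$, the matrix with ones in positions $(1,\ell)$ and $(i+1,i)$, $1\le i<\ell$, and zeros elsewhere. Let $\rho:G\to D_\ell$ be any surjective homomorphism and $\phi=\pi\circ\rho$. With $\partial w/\partial a$ the Fox derivative, let $$\hat A_\phi=I+(t\phi(a)-I)\left.\frac{\partial w}{\partial a}\right|_{a=t\phi(a),\,b=t\phi(b)}$$ (the group ring element $1$ is replaced by the identity matrix). The $\ell$-twisted Alexander polynomial is $\tilde\Delta^\ell_{1/q}(t)=\det\hat A_\phi/\det(t\phi(b)-I)$,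 considered up to factors $\pm t^{r\ell}$; up to such factors it does not depend on $\rho$. *)

(* Defs.v *)
From HB Require Import structures.
From mathcomp Require Import all_boot all_order all_algebra.
From mathcomp Require Import generic_quotient fraction complex boolp reals.

Set Implicit Arguments.
Unset Strict Implicit.
Unset Printing Implicit Defensive.

Import GRing.Theory.

Local Open Scope ring_scope.
Local Open Scope quotient_scope.

(* The letter (x, true) is the generator x, the letter (x, false) is its
   inverse; words are not assumed to be reduced. *)
Definition word (X : Type) := seq (X * bool).

Definition word_inv (X : Type) (u : word X) : word X :=
  rev [seq (s.1, ~~ s.2) | s <- u].

Section Presentation.
Variables (X : choiceType) (rels : seq (word X * word X)).

(* A pair (u, v) in rels is the relation u = v. *)
Inductive pres_eq : word X -> word X -> Prop :=
| pres_refl u : pres_eq u u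
| pres_sym u v : pres_eq u v -> pres_eq v u
| pres_trans u v z : pres_eq u v -> pres_eq v z -> pres_eq u z
| pres_cat u u' v v' :
    pres_eq u u' -> pres_eq v v' -> pres_eq (u ++ v) (u' ++ v')
| pres_cancel x e : pres_eq [:: (x, e); (x, ~~ e)] [::]
| pres_rel r : r \in rels -> pres_eq r.1 r.2.

Definition pres_eqb (u v : word X) : bool := `[< pres_eq u v >].

Lemma pres_eqb_refl : reflexive pres_eqb.
Proof. by move=> u; apply/asboolP; exact: pres_refl. Qed.

Lemma pres_eqb_sym : symmetric pres_eqb.
Proof. by move=> u v; apply/asboolP/asboolP; exact: pres_sym. Qed.

Lemma pres_eqb_trans : transitive pres_eqb.
Proof.
by move=> v u z /asboolP uv /asboolP vz; apply/asboolP; exact: pres_trans vz.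
Qed.

Canonical pres_equiv :=
  EquivRel pres_eqb pres_eqb_refl pres_eqb_sym pres_eqb_trans.

Definition presented := {eq_quot pres_equiv}.
HB.instance Definition _ := Choice.on presented.

Definition pres_class (u : word X) : presented := \pi_presented u.

Lemma pres_classP u v : pres_class u = pres_class v <-> pres_eq u v.
Proof. by split=> [/eqmodP/asboolP|uv]; last exact/eqmodP/asboolP. Qed.

Lemma pres_classK g : pres_class (repr g) = g.
Proof. exact: reprK. Qed.

Lemma pres_eq_repr u : pres_eq (repr (pres_class u)) u.
Proof. by apply/pres_classP; rewrite pres_classK. Qed.

Lemma word_invK : involutive (@word_inv X).
Proof.
move=> u; rewrite /word_inv map_rev revK -map_comp map_id_in //.
by case=> x e _ /=; rewrite negbK.
Qed.

Lemma pres_mulV u : pres_eq (u ++ word_inv u) [::].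
Proof.
elim: u => [|[x e] u IHu]; first exact: (pres_refl [::]).
have -> : ((x, e) :: u) ++ word_inv ((x, e) :: u)
    = [:: (x, e)] ++ ((u ++ word_inv u) ++ [:: (x, ~~ e)]).
  by rewrite /word_inv /= rev_cons -cats1 !catA.
apply: (pres_trans _ (pres_cancel x e)).
rewrite -[[:: (x, e); _]]/([:: (x, e)] ++ ([::] ++ [:: (x, ~~ e)])).
apply: pres_cat (pres_refl _) _.
exact: pres_cat IHu (pres_refl _).
Qed.

Lemma pres_Vmul u : pres_eq (word_inv u ++ u) [::].
Proof. by rewrite -{2}[u]word_invK; exact: pres_mulV. Qed.

Definition pres_one : presented := pres_class [::].
Definition pres_mul (g h : presented) : presented :=
  pres_class (repr g ++ repr h).
Definition pres_inv (g : presented) : presented :=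
  pres_class (word_inv (repr g)).

Lemma pres_mulE u v :
  pres_mul (pres_class u) (pres_class v) = pres_class (u ++ v).
Proof. by apply/pres_classP/pres_cat; exact: pres_eq_repr. Qed.

Lemma pres_mulA : associative pres_mul.
Proof.
by move=> g h k; rewrite -[g]pres_classK -[h]pres_classK -[k]pres_classK
  !pres_mulE catA.
Qed.

Lemma pres_mul1 : left_id pres_one pres_mul.
Proof. by move=> g; rewrite -[g]pres_classK pres_mulE. Qed.

Lemma pres_mulr1 : right_id pres_one pres_mul.
Proof. by move=> g; rewrite -[g]pres_classK pres_mulE cats0. Qed.

Lemma pres_mulVg : left_inverse pres_one pres_inv pres_mul.
Proof.
move=> g; rewrite -{2}[g]pres_classK pres_mulE.
exact/pres_classP/pres_Vmul.
Qed.

Lemma pres_mulgV : right_inverse pres_one pres_inv pres_mul.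
Proof.
move=> g; rewrite -{1}[g]pres_classK pres_mulE.
exact/pres_classP/pres_mulV.
Qed.

HB.instance Definition _ := isGroup.Build presented
  pres_mulA pres_mul1 pres_mulr1 pres_mulVg pres_mulgV.

Definition pres_gen (x : X) : presented := pres_class [:: (x, true)].

End Presentation.

Section GeneralLinear.
Variables (n : nat) (K : comUnitRingType).

Record GL := MkGL { GL_mx :> 'M[K]_n; GL_unitmx : GL_mx \in unitmx }.

HB.instance Definition _ := [isSub for GL_mx].
HB.instance Definition _ := [Choice of GL by <:].

Definition GL_one : GL := MkGL (unitmx1 K n).

Lemma GL_mul_subproof (A B : GL) : A *m B \in unitmx.
Proof. by rewrite unitmx_mul !GL_unitmx. Qed.

Lemma GL_inv_subproof (A : GL) : invmx A \in unitmx.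
Proof. by rewrite unitmx_inv GL_unitmx. Qed.

Definition GL_mul (A B : GL) : GL := MkGL (GL_mul_subproof A B).
Definition GL_inv (A : GL) : GL := MkGL (GL_inv_subproof A).

Lemma GL_mulA : associative GL_mul.
Proof. by move=> A B C; apply: val_inj; rewrite /= mulmxA. Qed.

Lemma GL_mul1 : left_id GL_one GL_mul.
Proof. by move=> A; apply: val_inj; rewrite /= mul1mx. Qed.

Lemma GL_mulr1 : right_id GL_one GL_mul.
Proof. by move=> A; apply: val_inj; rewrite /= mulmx1. Qed.

Lemma GL_mulV : left_inverse GL_one GL_inv GL_mul.
Proof. by move=> A; apply: val_inj; rewrite /= mulVmx ?GL_unitmx. Qed.

Lemma GL_mulrV : right_inverse GL_one GL_inv GL_mul.
Proof. by move=> A; apply: val_inj; rewrite /= mulmxV ?GL_unitmx. Qed.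

HB.instance Definition _ := isGroup.Build GL
  GL_mulA GL_mul1 GL_mulr1 GL_mulV GL_mulrV.

End GeneralLinear.

Section FoxCalculus.
Variable X : eqType.

(* A formal sum \sum_k c_k u_k in the integral group ring of the free group
   on X, given by its list of terms (c_k, u_k). *)
Definition zword := seq (int * word X).

(* d(y u) = dy + y du, with dx = 1, d(x^-1) = - x^-1, and dy = d(y^-1) = 0
   for y != x. *)
Fixpoint fox (x : X) (u : word X) : zword :=
  if u is (y, e) :: v then
    (if y == x then [:: if e then (1, [::]) else (-1, [:: (y, false)])]
     else [::])
    ++ [seq (c.1, (y, e) :: c.2) | c <- fox x v]
  else [::].

Variables (K : comUnitRingType) (n : nat) (f : X -> 'M[K]_n).

Definition word_mx (u : word X) : 'M[K]_n :=
  foldr (fun s A => (if s.2 then f s.1 else invmx (f s.1)) *m A) 1%:M u.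

Definition zword_mx (z : zword) : 'M[K]_n :=
  \sum_(c <- z) (word_mx c.2 *~ c.1).

End FoxCalculus.

Definition gen_a : bool := false.
Definition gen_b : bool := true.

(* The group of the (2, q)-torus knot K_{1/q}, q odd, is <a, b | a w = w b> with
   w = (b a)^((q - 1)/2). *)
Definition knot_word (q : nat) : word bool :=
  flatten (nseq q.-1./2 [:: (gen_b, true); (gen_a, true)]).

Definition knot_group (q : nat) :=
  presented [:: ((gen_a, true) :: knot_word q,
                 rcons (knot_word q) (gen_b, true))].

Definition knot_a q : knot_group q := pres_gen _ gen_a.
Definition knot_b q : knot_group q := pres_gen _ gen_b.

Definition gen_x : bool := false.
Definition gen_y : bool := true.

(* <x, y | x^2 = 1, y^l = 1, y x = x y^-1> *)
Definition dihedral (l : nat) :=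
  presented [:: ([:: (gen_x, true); (gen_x, true)], [::]);
                (nseq l (gen_y, true), [::]);
                ([:: (gen_y, true); (gen_x, true)],
                 [:: (gen_x, true); (gen_y, false)])].

Definition dihedral_x l : dihedral l := pres_gen _ gen_x.
Definition dihedral_y l : dihedral l := pres_gen _ gen_y.

(* Indices start at 0, so the entry (1, l) becomes (0, l - 1). *)
Definition flip_mx (K : nzRingType) (l : nat) : 'M[K]_l :=
  \matrix_(i, j) ((i + j).+1 == l)%:R.

Definition rot_mx (K : nzRingType) (l : nat) : 'M[K]_l :=
  \matrix_(i, j) ((val i == j.+1) || (val i == 0) && (j.+1 == l))%:R.

Notation ratfun K := {fraction {poly K}}.

Section TwistedAlexander.
Variable K : fieldType.

Definition tvar : ratfun K := tofrac 'X.

Definition tscale (n : nat) (A : 'M[K]_n) : 'M[ratfun K]_n :=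
  tvar *: map_mx (fun c => tofrac c%:P) A.

Variables (q l : nat) (phi : {multiplicative knot_group q -> GL l K}).

(* The substitution a = t phi(a), b = t phi(b). *)
Definition twisted_subst (g : bool) : 'M[ratfun K]_l :=
  tscale (phi (pres_gen _ g)).

Definition Ahat : 'M[ratfun K]_l :=
  1%:M + (tscale (phi (knot_a q)) - 1%:M)
         *m zword_mx twisted_subst (fox gen_a (knot_word q)).

Definition twisted_alexander : ratfun K :=
  \det Ahat / \det (tscale (phi (knot_b q)) - 1%:M).

End TwistedAlexander.

Definition alexander_torus (K : fieldType) (q : nat) : {poly K} :=
  \sum_(i < q) (-1) ^+ i *: 'X^i.

Definition eq_upto_unit (K : fieldType) (l : nat) (f g : ratfun K) : Prop :=
  exists (s : bool) (r : int), f = (-1) ^+ s * tvar K ^ (r * l%:Z) * g.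

(* Main.v *)
Require Import Defs.
From HB Require Import structures.
From mathcomp Require Import all_boot all_order all_algebra.
From mathcomp Require Import generic_quotient fraction complex boolp reals.
From mathcomp Require Import zify ring.

Import GRing.Theory.
Local Open Scope ring_scope.

(* Write A, B and W for the images of a, b and w = (ba)^((q-1)/2) under
   g |-> t phi(g). Fox's formula gives (dw/da) (AB - 1) = WB - B, so the relation
   AW = WB yields Ahat (AB - 1) = (1 + WB) (B - 1) and the twisted polynomial
   equals det (1 + WB) / det (AB - 1). Since rho is onto, a and b go to distinct
   reflections: WB is t^q times a reflection and AB is t^2 times a nontrivial
   rotation, so both determinants are explicit. *)

(** * Determinants built on the flip and on the basic rotation *)

Lemma sum_mul_delta (F : nzRingType) n (f : 'I_n -> F) (a : 'I_n) :
  \sum_k f k * (k == a)%:R = f a.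
Proof.
rewrite (bigD1 a) //= eqxx mulr1 big1 ?addr0 // => k /negPf ->.
by rewrite mulr0.
Qed.

Lemma flip_mx_sqr (F : nzRingType) l : flip_mx F l *m flip_mx F l = 1%:M.
Proof.
apply/matrixP => i j; rewrite !mxE.
rewrite (eq_bigr (fun k => (i == j)%:R * (k == rev_ord j)%:R)).
  by rewrite sum_mul_delta.
move=> k _; rewrite !mxE -!natrM !mulnb -!val_eqE /=; congr (nat_of_bool _)%:R.
have [li lj lk] := And3 (ltn_ord i) (ltn_ord j) (ltn_ord k).
apply/andP/andP => -[/eqP e1 /eqP e2]; split; apply/eqP; lia.
Qed.

(** The flip swaps the indices [j] and [l - 1 - j]: each of the [(l.-1)./2] pairs gives a 2x2 block
    of determinant [1 - s ^+ 2], and the middle index, fixed because [l] is odd, gives [1 + s]. *)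
Lemma det_add_flip_mx (F : comNzRingType) l (s : F) : odd l ->
  \det (1%:M + s *: flip_mx F l) = (1 + s) * (1 - s ^+ 2) ^+ (l.-1)./2.
Proof.
move=> l_odd; set h := (l.-1)./2.
have lE : l = (h + h.+1)%N by rewrite /h; lia.
move: h lE => h lE {l_odd}.
(* [d] selects the columns to the right of the middle one, which makes [T] upper unitriangular. *)
pose d : 'rV[F]_l := \row_j (h < j)%:R.
pose T : 'M[F]_l := 1%:M - s *: (flip_mx F l *m diag_mx d).
(* Column j of the product is cleared above the diagonal by column l-1-j. *)
have prodE i j : ((1%:M + s *: flip_mx F l) *m T) i j =
    if (h < j)%N then (1 - s ^+ 2) * (i == j)%:R
    else (i == j)%:R + s * flip_mx F l i j.
  rewrite /T mulmxBr mulmx1 -scalemxAr mulmxDl mul1mx -scalemxAl mulmxA.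
  rewrite flip_mx_sqr mul1mx mul_mx_diag !mxE.
  by case: (i =P j) => [->|_]; case: (h < j)%N; rewrite /= ?mulr1n ?mulr0n; ring.
have TE i j : T i j = (i == j)%:R - s * (flip_mx F l i j * (h < j)%:R).
  by rewrite /T mul_mx_diag !mxE.
have detT : \det T = 1.
  rewrite -det_tr det_trig.
    rewrite big1 // => i _; rewrite mxE TE mxE eqxx.
    case: ltnP => hi; rewrite ?mulr0 ?subr0 //.
    by case: eqP => [|_]; [lia | rewrite mul0r mulr0 subr0].
  apply/is_trig_mxP => i j ij; rewrite mxE TE mxE -val_eqE gtn_eqF //.
  case: ltnP => hi; rewrite ?mulr0 ?subr0 //.
  by case: eqP => [|_]; [lia | rewrite mul0r mulr0 subr0].
rewrite -[LHS]mulr1 -[X in _ * X = _]detT -det_mulmx det_trig; last first.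
  apply/is_trig_mxP => i j ij; rewrite prodE -val_eqE ltn_eqF //.
  rewrite mulr0; case: ltnP => // hj; rewrite !mxE.
  by case: eqP => [|_]; [lia | rewrite mulr0 addr0].
rewrite (eq_bigr _ (fun i _ => prodE i i)).
(* On the diagonal, the first [h] entries are 1, the middle one is [1 + s] and the last [h] are
   [1 - s ^+ 2]. *)
clear d T TE prodE detT; subst l; rewrite big_split_ord big_ord_recl /=.
rewrite big1 ?mul1r => [|i _]; last first.
  rewrite eqxx mxE ltnNge ltnW //=.
  by case: eqP => [|_]; [have := ltn_ord i; lia | rewrite mulr0 addr0].
congr (_ * _).
  rewrite eqxx mxE addn0 ltnn.
  by case: eqP => [_|]; [rewrite mulr1 | rewrite /=; lia].
rewrite -[h in RHS]card_ord -prodr_const; apply: eq_bigr => i _.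
by rewrite eqxx mulr1 /bump /= add1n -addSnnS ltn_addr.
Qed.

Lemma rot_mxE (F : nzRingType) l (i j : 'I_l) :
  rot_mx F l i j = (i == ordS j)%:R.
Proof.
rewrite mxE -val_eqE /=; congr (nat_of_bool _)%:R.
have [li lj] := (ltn_ord i, ltn_ord j).
have [e|ne] := eqVneq j.+1 l; first by rewrite {2}e modnn; lia.
by rewrite modn_small; lia.
Qed.

(** Multiplying by a lower unitriangular matrix leaves an upper triangular one; the powers of [s]
    accumulate once around the cycle and end in the last diagonal entry. *)
Lemma det_sub_rot_mx (F : comNzRingType) l (s : F) : (0 < l)%N ->
  \det (1%:M - s *: rot_mx F l) = 1 - s ^+ l.
Proof.
case: l => // p _.
pose T : 'M[F]_p.+1 := \matrix_(i, j) (s ^+ (i - j) *+ (j <= i)%N).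
have detT : \det T = 1.
  rewrite det_trig.
    by rewrite big1 // => i _; rewrite mxE leqnn subnn.
  by apply/is_trig_mxP => i j ij; rewrite mxE leqNgt ij.
(* T is the inverse of 1 - s N, with N the part of the rotation below the
   diagonal, so only the last column of the product is not a unit vector. *)
have prodE i j : (T *m (1%:M - s *: rot_mx F p.+1)) i j =
    (i == j)%:R - s ^+ i.+1 *+ (j == ord_max).
  rewrite mulmxBr mulmx1 -scalemxAr !mxE.
  under eq_bigr => k _ do rewrite rot_mxE.
  rewrite sum_mul_delta mxE -!val_eqE /=.
  have [li lj] := (ltn_ord i, ltn_ord j).
  have [->|ne] := eqVneq (j : nat) p.
    rewrite modnn subn0 mulr1n -exprS; congr (_ - _).
    have [->|ne] := eqVneq (i : nat) p; first by rewrite leqnn subnn.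
    by rewrite (leqNgt p); have -> : (i < p)%N by lia.
  rewrite modn_small; last by lia.
  rewrite mulr0n subr0; case: (ltngtP i j) => ij.
  - by rewrite !mulr0n mulr0 subr0.
  - by rewrite mulr1n -exprS subnSK // subrr.
  - by rewrite ij subnn mulr0n mulr0 subr0.
rewrite -[LHS]mul1r -[X in X * _ = _]detT -det_mulmx -det_tr det_trig; last first.
  apply/is_trig_mxP => i j ij; rewrite mxE prodE -!val_eqE /= gtn_eqF //.
  have lj := ltn_ord j.
  by rewrite (_ : (i == p :> nat) = false) ?mulr0n ?subr0 //; lia.
rewrite big_ord_recr /= big1 => [|i _]; rewrite mxE prodE !eqxx ?mul1r //.
by rewrite -val_eqE /= ltn_eqF ?ltn_ord // subr0.
Qed.

(** * Rotations and reflections as affine maps of Z/(p+2) *)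

(* The matrix of the affine map j |-> e j + k of Z/(p+2): the rotations are the
   case e = 1 and the reflections the case e = -1. *)
Definition aff_mx (F : nzRingType) {p} (e k : 'I_p.+2) : 'M[F]_p.+2 :=
  \matrix_(i, j) (i == e * j + k)%:R.

Lemma aff_mxM (F : nzRingType) p (e k e' k' : 'I_p.+2) :
  aff_mx F e k *m aff_mx F e' k' = aff_mx F (e * e') (e * k' + k).
Proof.
apply/matrixP => i j; rewrite !mxE.
under eq_bigr => m _ do rewrite !mxE.
by rewrite sum_mul_delta mulrDr mulrA addrA.
Qed.

Lemma aff_mx1 (F : nzRingType) p : aff_mx F 1 0 = 1%:M :> 'M_p.+2.
Proof. by apply/matrixP => i j; rewrite !mxE mul1r addr0. Qed.

Lemma aff_mx_inj (F : nzRingType) p (e k e' k' : 'I_p.+2) :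
  aff_mx F e k = aff_mx F e' k' -> e = e' /\ k = k'.
Proof.
move/matrixP => E.
have Ej j : e * j + k = e' * j + k'.
  have := E (e * j + k) j; rewrite !mxE eqxx.
  by case: eqP => // _ /eqP; rewrite oner_eq0.
have kk : k = k' by have := Ej 0; rewrite !mulr0 !add0r.
by split=> //; have := Ej 1; rewrite !mulr1 kk => /addIr.
Qed.

(** As [i + j + 1] is positive and less than twice [p.+2], it equals [p.+2] exactly when
    [i = - j - 1] modulo [p.+2]. *)
Lemma flip_mx_aff (F : nzRingType) p : flip_mx F p.+2 = aff_mx F (-1) (-1).
Proof.
apply/matrixP => i j; rewrite !mxE; congr (nat_of_bool _)%:R.
rewrite mulN1r -opprD -subr_eq0 opprK addrA -val_eqE /=.
rewrite modnDm addn1.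
have [li lj] := (ltn_ord i, ltn_ord j).
have [->|ne] := eqVneq (i + j).+1 p.+2; first by rewrite modnn.
have [lt|ge] := ltnP (i + j).+1 p.+2; first by rewrite modn_small.
rewrite -{1}(subnK ge) modnDr modn_small; lia.
Qed.

Lemma rot_mx_aff (F : nzRingType) p : rot_mx F p.+2 = aff_mx F 1 1.
Proof.
apply/matrixP => i j; rewrite rot_mxE !mxE mul1r; congr (i == _)%:R.
by apply: val_inj; rewrite /= modnDmr addn1.
Qed.

Lemma det_add_similar (F : comNzRingType) n (P Q A B : 'M[F]_n) (s : F) :
  P *m Q = 1%:M -> P *m A = B *m P ->
  \det (1%:M + s *: A) = \det (1%:M + s *: B).
Proof.
move=> PQ PA; have dPQ : \det P * \det Q = 1 by rewrite -det_mulmx PQ det1.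
rewrite -[LHS]mul1r -[X in X * _ = _]dPQ mulrAC -!det_mulmx mulmxDr mulmx1.
by rewrite -scalemxAr PA scalemxAl -[P in P + _]mul1mx -mulmxDl -mulmxA PQ mulmx1.
Qed.

Lemma Zp_mulrn_modulus p (x : 'I_p.+2) : x *+ p.+2 = 0.
Proof.
rewrite -mulr_natr Zp_nat (_ : inZp _ = 0) ?mulr0 //.
by apply: val_inj; rewrite /= modnn.
Qed.

(** In odd size, every reflection is conjugate to the flip by a translation. *)
Lemma det_add_refl_mx (F : comNzRingType) p (k : 'I_p.+2) (s : F) :
  odd p.+2 ->
  \det (1%:M + s *: aff_mx F (-1) k) = (1 + s) * (1 - s ^+ 2) ^+ (p.+1)./2.
Proof.
move=> p_odd; rewrite -(@det_add_flip_mx F p.+2 s p_odd).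
(* Conjugating by [j |-> j + c] requires [c + c = k + 1]; [(p.+3)./2] is the inverse of 2 modulo
   [p.+2]. *)
pose c : 'I_p.+2 := (k + 1) *+ (p.+3)./2.
have cc : c + c = k + 1.
  rewrite /c -mulrnDr addnn.
  have -> : ((p.+3)./2.*2 = p.+3)%N by lia.
  by rewrite mulrS Zp_mulrn_modulus addr0.
apply: esym (@det_add_similar F _ (aff_mx F 1 c) (aff_mx F 1 (- c)) _ _ s _ _).
  by rewrite aff_mxM !mul1r addNr aff_mx1.
rewrite flip_mx_aff !aff_mxM !mul1r mulr1; congr (aff_mx F _ _).
by rewrite mulN1r -[k](addrK 1) -cc; ring.
Qed.

Lemma Zp_prime_unit p (k : 'I_p.+2) :
  prime p.+2 -> k != 0 -> k \is a GRing.unit.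
Proof.
move=> p_pr k0; have := @unitZpE p.+2 k isT.
rewrite natr_Zp => ->; rewrite prime_coprime // gtnNdvd //.
by rewrite lt0n.
Qed.

(** Primality makes [k] a unit, and [j |-> k * j] conjugates the rotation by 1 into the rotation by
    [k]. *)
Lemma det_sub_rot_aff_mx (F : comNzRingType) p (k : 'I_p.+2) (s : F) :
  prime p.+2 -> k != 0 ->
  \det (1%:M - s *: aff_mx F 1 k) = 1 - s ^+ p.+2.
Proof.
move=> p_pr k0; have ku := Zp_prime_unit _ _ p_pr k0.
rewrite -[RHS]det_sub_rot_mx // -!scaleNr rot_mx_aff.
apply: esym (@det_add_similar F _ (aff_mx F k 0) (aff_mx F k^-1 0) _ _ _ _ _).
  by rewrite aff_mxM mulr0 addr0 divrr // aff_mx1.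
by rewrite !aff_mxM !mul1r !mulr1 addr0 add0r.
Qed.

(** * Fox calculus of the knot relator *)

(** The derivative of a power of [ba] is the geometric sum of the [(ba)^i b], and it telescopes
    because [B (AB - 1) = (BA - 1) B]. *)
Lemma fox_derivative_mul (F : comUnitRingType) n (f : bool -> 'M[F]_n) q :
  let A := f gen_a in let B := f gen_b in
  zword_mx f (fox gen_a (knot_word q)) *m (A *m B - 1%:M) =
  word_mx f (knot_word q) *m B - B.
Proof.
move=> A B; rewrite /knot_word; elim: (q.-1./2) => [|m IHm] /=.
  by rewrite /zword_mx big_nil mul0mx mul1mx subrr.
set W := word_mx _ _ in IHm *; set z := fox _ _ in IHm *.
have -> : zword_mx f ((1, [:: (gen_b, true)]) :: [seq (c.1, (gen_b, true) :: c.2)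
      | c <- [seq (c.1, (gen_a, true) :: c.2) | c <- z]])
    = B + B *m A *m zword_mx f z.
  rewrite /zword_mx big_cons -map_comp big_map /= mulmx1 mulr1z; congr (_ + _).
  by rewrite mulmx_sumr; apply: eq_bigr => c _;
    rewrite (raddfMz (mulmx (B *m A))) /= mulmxA.
rewrite mulmxDl -mulmxA IHm !mulmxBr !mulmx1 !mulmxA.
by rewrite [B *m A *m B - B + _]addrC addrA subrK.
Qed.

(** By the previous formula the left side expands to [AWB - WB + B - 1], and the relation turns
    [AWB] into [WBB]. *)
Lemma fox_relator_mul (F : comUnitRingType) n (f : bool -> 'M[F]_n) q :
  let A := f gen_a in let B := f gen_b in
  let W := word_mx f (knot_word q) in
  A *m W = W *m B ->
  (1%:M + (A - 1%:M) *m zword_mx f (fox gen_a (knot_word q)))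
    *m (A *m B - 1%:M) = (1%:M + W *m B) *m (B - 1%:M).
Proof.
move=> A B W AW; rewrite mulmxDl mul1mx -mulmxA fox_derivative_mul -/B -/W.
rewrite !mulmxBl !mulmxBr !mulmxDl !mul1mx !mulmx1 !mulmxA AW.
rewrite opprB addrA [_ + (_ - A *m B)]addrC subrKA addrACA -opprD.
by rewrite [W *m B *m B + B]addrC.
Qed.

Lemma word_mx_knot_word (F : comUnitRingType) p (k : bool -> 'I_p.+2)
    (f : bool -> 'M[F]_p.+2) (t : F) q :
  (forall g, f g = t *: aff_mx F (-1) (k g)) ->
  word_mx f (knot_word q) =
  t ^+ (q.-1)./2.*2 *: aff_mx F 1 ((k gen_b - k gen_a) *+ (q.-1)./2).
Proof.
move=> fE; rewrite /knot_word; elim: (q.-1./2) => [|m IHm] /=.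
  by rewrite aff_mx1 scale1r.
rewrite IHm !fE -!scalemxAl -!scalemxAr !scalerA !aff_mxM -!exprS.
congr (_ *: aff_mx F _ _); first by ring.
by rewrite mulrS; ring.
Qed.

(** * Images of the knot generators in the dihedral representation *)

Lemma GL_morphM (G : groupType) (K : comUnitRingType) n
    (f : {multiplicative G -> GL n K}) (g h : G) :
  GL_mx (f (g * h)%g) = GL_mx (f g) *m GL_mx (f h).
Proof. by rewrite gmulfM. Qed.

Lemma GL_morph1 (G : groupType) (K : comUnitRingType) n
    (f : {multiplicative G -> GL n K}) : GL_mx (f 1%g) = 1%:M.
Proof.
suff -> : f 1%g = 1%g by [].
by apply: (mulgI (f 1%g)); rewrite -gmulfM !mulg1.
Qed.

Lemma GL_morphV (G : groupType) (K : comUnitRingType) n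
    (f : {multiplicative G -> GL n K}) (g : G) (A : 'M[K]_n) :
  GL_mx (f g) *m A = 1%:M -> GL_mx (f (g^-1)%g) = A.
Proof.
move=> fA; rewrite -[RHS]mul1mx -(GL_morph1 _ _ _ f) -(mulVg g) GL_morphM.
by rewrite -mulmxA fA mulmx1.
Qed.

(** Reduces statements about the image of a homomorphism to the generators, for both [dihedral] and
    [knot_group]. *)
Lemma pres_ind (X : choiceType) (rels : seq (word X * word X))
    (P : presented rels -> Prop) :
  P 1%g -> (forall g h, P g -> P h -> P (g * h)%g) ->
  (forall g, P g -> P (g^-1)%g) ->
  (forall x, P (pres_gen rels x)) -> forall g, P g.
Proof.
move=> P1 PM PV Pgen g; rewrite -[g]pres_classK; elim: (repr g) => [//|[x e] u IHu].
rewrite -cat1s -pres_mulE; apply: PM => //.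
case: e; first exact: Pgen.
suff -> : pres_class rels [:: (x, false)] = (pres_gen rels x)^-1%g.
  exact: PV (Pgen x).
apply: (mulgI (pres_gen rels x)); rewrite mulgV.
rewrite [LHS]pres_mulE; apply/pres_classP; exact: pres_cancel.
Qed.

Lemma dihedral_rep_aff (K : comUnitRingType) p
    (pi : {multiplicative dihedral p.+2 -> GL p.+2 K}) d :
  GL_mx (pi (dihedral_x p.+2)) = flip_mx K p.+2 ->
  GL_mx (pi (dihedral_y p.+2)) = rot_mx K p.+2 ->
  exists e k, (e = 1 \/ e = -1) /\ GL_mx (pi d) = aff_mx K e k.
Proof.
rewrite flip_mx_aff rot_mx_aff => pi_x pi_y; elim/pres_ind: d.
- by exists 1, 0; split; [left | rewrite GL_morph1 aff_mx1].
- move=> g h [e [k [He Ee]]] [e' [k' [He' Ee']]].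
  exists (e * e'), (e * k' + k); rewrite GL_morphM Ee Ee' aff_mxM; split=> //.
  by case: He He' => -> [] ->; rewrite ?mulrNN ?mulr1 ?mul1r;
    [left | right | right | left].
(* As [e * e = 1], the inverse of [j |-> e j + k] is [j |-> e j - e k]. *)
- move=> g [e [k [He Ee]]]; exists e, (- (e * k)); split=> //.
  have ee : e * e = 1 by case: He => ->; rewrite ?mulrNN mulr1.
  by apply: GL_morphV; rewrite Ee aff_mxM mulrN mulrA ee mul1r addNr aff_mx1.
- by case; [exists 1, 1; split; [left|] | exists (-1), (-1); split; [right|]].
Qed.

Lemma Zp_odd_neqN1 p : odd p.+2 -> (1 : 'I_p.+2) <> -1.
Proof.
move=> p_odd /eqP; rewrite -subr_eq0 opprK -val_eqE /= modnDm.
by case: p p_odd => // p _; rewrite modn_small.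
Qed.

(** Surjectivity excludes every other case: two rotations generate only rotations and miss [x],
    while a single reflection generates a group of order two and misses [y]. *)
Lemma knot_rep_aff (K : comUnitRingType) p q
    (pi : {multiplicative dihedral p.+2 -> GL p.+2 K})
    (rho : {multiplicative knot_group q -> dihedral p.+2}) :
  odd p.+2 ->
  GL_mx (pi (dihedral_x p.+2)) = flip_mx K p.+2 ->
  GL_mx (pi (dihedral_y p.+2)) = rot_mx K p.+2 ->
  (forall d, exists g, rho g = d) ->
  exists k : bool -> 'I_p.+2, k gen_a != k gen_b /\
    forall g, GL_mx (pi (rho (pres_gen _ g))) = aff_mx K (-1) (k g).
Proof.
move=> p_odd pi_x pi_y rho_surj.
have one_neqN1 := Zp_odd_neqN1 p p_odd.
have affE d := dihedral_rep_aff K p pi d pi_x pi_y.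
have [ea [ka [Hea Ea]]] := affE (rho (knot_a q)).
have [eb [kb [Heb Eb]]] := affE (rho (knot_b q)).
(* The relation makes [a] and [b] conjugate, so their linear parts agree. *)
have eab : ea = eb.
  set w : knot_group q := pres_class _ (knot_word q).
  have aw : (knot_a q * w = w * knot_b q)%g.
    rewrite [LHS]pres_mulE [RHS]pres_mulE; apply/pres_classP.
    rewrite cats1; exact: (pres_rel (mem_head _ _)).
  have [ew [kw [Hew Ew]]] := affE (rho w).
  have := congr1 (fun g => GL_mx (pi (rho g))) aw.
  rewrite !gmulfM /= Ea Eb Ew !aff_mxM => /aff_mx_inj[+ _].
  by rewrite mulrC; case: Hew => ->; rewrite ?mul1r // !mulN1r => /oppr_inj.
subst eb.
pose f := pi \o rho.
case: Hea => Hea; subst ea.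
  have im g : exists k, GL_mx (f g) = aff_mx K 1 k.
    elim/pres_ind: g.
    - by exists 0; rewrite GL_morph1 aff_mx1.
    - move=> g h [k Ek] [k' Ek']; exists (k' + k).
      by rewrite GL_morphM Ek Ek' aff_mxM !mul1r.
    - move=> g [k Ek]; exists (- k); apply: GL_morphV.
      by rewrite Ek aff_mxM !mul1r addNr aff_mx1.
    - by case; [exists kb | exists ka].
  have [g rg] := rho_surj (dihedral_x p.+2); have [k] := im g.
  by rewrite /f /= rg pi_x flip_mx_aff => /aff_mx_inj[/esym].
exists (fun g => if g then kb else ka); split; last by case.
apply/eqP => /= kab; subst kb.
have im g : GL_mx (f g) = aff_mx K 1 0 \/ GL_mx (f g) = aff_mx K (-1) ka.
  elim/pres_ind: g.
  - by left; rewrite GL_morph1 aff_mx1.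
  - move=> g h; rewrite GL_morphM => -[] -> [] ->; rewrite aff_mxM.
    + by left; rewrite !mul1r addr0.
    + by right; rewrite !mul1r addr0.
    + by right; rewrite mulr1 mulr0 add0r.
    + by left; rewrite mulrNN mulN1r mulr1 addNr.
  - move=> g [] E; [left | right]; apply: GL_morphV; rewrite E aff_mxM -aff_mx1.
    + by rewrite mul1r mulr0 addr0.
    + by rewrite mulrNN mulN1r mulr1 addNr.
  - by case; right.
have [g rg] := rho_surj (dihedral_y p.+2).
by have [] := im g; rewrite /f /= rg pi_y rot_mx_aff => /aff_mx_inj[].
Qed.

(** * The twisted polynomial in closed form *)

(** To be read with [u = t ^+ q] and [v = t ^+ l]; the sign on the left is the quotient of [1 - t]
    by [t - 1]. *)
Lemma alexander_quotient (F : fieldType) (D t u v : F) h :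
  D * (1 + t) = 1 + u -> 1 - t != 0 -> 1 - v ^+ 2 != 0 ->
  (1 + u) * (1 - u ^+ 2) ^+ h / - (1 - v ^+ 2) =
  D / (t - 1) * ((1 + t) * (1 + u) ^+ h / (1 + v))
              * ((1 - t) * (1 - u) ^+ h / (1 - v)).
Proof.
move=> DE t1; have v2 : 1 - v ^+ 2 = (1 - v) * (1 + v) by ring.
have -> : 1 - u ^+ 2 = (1 - u) * (1 + u) by ring.
rewrite v2 exprMn mulf_eq0 negb_or => /andP[v_neg v_pos].
rewrite -[X in X * _ / _]DE.
move: (_ ^+ h) (_ ^+ h) => x y.
field; rewrite v_neg v_pos -oppr_eq0 opprB t1 /=.
by rewrite oppr_eq0 mulf_neq0.
Qed.

Lemma divr_cross (F : fieldType) (a b c d : F) :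
  b != 0 -> d != 0 -> a * d = c * b -> a / b = c / d.
Proof. by move=> b0 d0 E; apply/eqP; rewrite eqr_div // E. Qed.

(** A geometric sum in [- t], whose [q]-th power is [- t ^+ q] for odd [q]. *)
Lemma alexander_torus_mul (K : fieldType) q : odd q ->
  tofrac (alexander_torus K q) * (1 + tvar K) = 1 + tvar K ^+ q.
Proof.
move=> q_odd.
have -> : tofrac (alexander_torus K q) = \sum_(i < q) (- tvar K) ^+ i.
  rewrite raddf_sum; apply: eq_bigr => i _.
  rewrite [RHS]exprNn /tvar -tofrac1 -tofracN -!tofracXn -tofracM.
  by rewrite -mul_polyC polyC_exp polyCN.
have := subrX1 (- tvar K) q.
rewrite exprNn -signr_odd q_odd expr1 mulN1r -!opprD mulNr => /oppr_inj.
by rewrite addrC => ->; rewrite addrC mulrC.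
Qed.

Lemma tvar_expr_neq1 (K : fieldType) n : (0 < n)%N -> 1 - tvar K ^+ n != 0.
Proof.
move=> n0; rewrite -tofrac1 -tofracXn -tofracB tofrac_eq0 -oppr_eq0 opprB.
by rewrite monic_neq0 // monicXnsubC.
Qed.

Lemma twisted_alexander_refl (K : fieldType) p q
    (phi : {multiplicative knot_group q -> GL p.+2 K})
    (k : bool -> 'I_p.+2) :
  prime p.+2 -> odd p.+2 -> odd q -> (p.+2 %| q)%N ->
  k gen_a != k gen_b ->
  (forall g, GL_mx (phi (pres_gen _ g)) = aff_mx K (-1) (k g)) ->
  let t := tvar K in
  twisted_alexander phi =
  (1 + t ^+ q) * (1 - t ^+ q ^+ 2) ^+ (p.+1)./2 / - (1 - t ^+ 2 ^+ p.+2).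
Proof.
move=> p_pr p_odd q_odd p_dvd kab phiE t.
pose f := twisted_subst phi.
have fE g : f g = t *: aff_mx _ (-1) (k g).
  rewrite /f /twisted_subst phiE /tscale.
  congr (_ *: _); apply/matrixP => i j; rewrite !mxE.
  by case: (_ == _); rewrite ?tofrac0 ?tofrac1.
pose W := word_mx f (knot_word q).
pose r := (k gen_b - k gen_a) *+ q.-1./2.
have WE : W = t ^+ q.-1./2.*2 *: aff_mx _ 1 r := word_mx_knot_word _ _ _ _ _ _ fE.
have qE : q = q.-1./2.*2.+1 by lia.
have WB : W *m f gen_b = t ^+ q *: aff_mx _ (-1) (k gen_b + r).
  rewrite WE fE -scalemxAl -scalemxAr scalerA aff_mxM !mul1r -exprSr.
  by rewrite -qE.
have AW : f gen_a *m W = W *m f gen_b.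
  rewrite WB WE fE -scalemxAl -scalemxAr scalerA aff_mxM mulr1 -exprS -qE.
  congr (_ *: aff_mx _ _ _).
  (* The translation parts of [WB] and [AW] differ by exactly this multiple, which vanishes because
     [p.+2] divides [q]. *)
  have : (k gen_b - k gen_a) *+ q = 0.
    by have [c ->] := dvdnP p_dvd; rewrite mulnC mulrnA Zp_mulrn_modulus mul0rn.
  rewrite {1}qE -addnn mulrS mulrnDr -/r => q0.
  apply/eqP; rewrite -subr_eq0 -oppr_eq0 -[X in _ == X]q0; apply/eqP; ring.
have := congr1 determinant (fox_relator_mul _ _ f q AW).
rewrite -/W !det_mulmx WB det_add_refl_mx //.
have detN n (M : 'M_n) : odd n -> \det (- M) = - \det M :> ratfun K.
  by move=> n_odd; rewrite -scaleN1r detZ -signr_odd n_odd expr1 mulN1r.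
(* [AB] is [t ^+ 2] times the rotation by [k gen_a - k gen_b], nontrivial by [kab]; the sign comes
   from the odd size. *)
have -> : \det (f gen_a *m f gen_b - 1%:M) = - (1 - t ^+ 2 ^+ p.+2).
  rewrite !fE -scalemxAl -scalemxAr scalerA aff_mxM mulrNN mulr1 -opprB detN //.
  by rewrite det_sub_rot_aff_mx // mulN1r addrC subr_eq0.
(* Needed to clear the denominator of the twisted polynomial. *)
have detB : \det (f gen_b - 1%:M) != 0.
  rewrite fE -opprB detN // oppr_eq0 -scaleNr det_add_refl_mx // sqrrN.
  by rewrite mulf_neq0 ?expf_neq0 ?tvar_expr_neq1 // -[t]expr1 tvar_expr_neq1.
have nz : - (1 - t ^+ 2 ^+ p.+2) != 0.
  by rewrite oppr_eq0 -exprM tvar_expr_neq1.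
rewrite -[\det (1%:M + _ *m _)]/(\det (Ahat phi)) /twisted_alexander.
rewrite -[tscale _]/(f gen_b).
move: (\det (Ahat _)) (\det (f gen_b - _)) (- (1 - _ ^+ p.+2)) detB nz.
move=> X Y Z Y0 Z0 E.
exact: (@divr_cross _ _ _ _ _ Y0 Z0 E).
Qed.

Theorem theorem12 (R : realType) (q l : nat)
    (q_odd : odd q) (l_prime : prime l) (l_odd : odd l) (l_dvd_q : (l %| q)%N)
    (pi : {multiplicative dihedral l -> GL l (complex R)})
    (pi_x : GL_mx (pi (dihedral_x l)) = flip_mx (complex R) l)
    (pi_y : GL_mx (pi (dihedral_y l)) = rot_mx (complex R) l)
    (rho : {multiplicative knot_group q -> dihedral l})
    (rho_surj : forall d : dihedral l, exists g : knot_group q, rho g = d) :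
  let t : ratfun (complex R) := tvar (complex R) in
  eq_upto_unit l
    (twisted_alexander (pi \o rho))
    (tofrac (alexander_torus (complex R) q) / (t - 1)
     * ((1 + t) * (1 + t ^+ q) ^+ (l.-1)./2 / (1 + t ^+ l))
     * ((1 - t) * (1 - t ^+ q) ^+ (l.-1)./2 / (1 - t ^+ l))).
Proof.
(* The two sides agree exactly, so the unit is taken to be 1. *)
move=> t; exists false, 0; rewrite expr0 mul0r expr0z !mul1r.
case: l l_prime l_odd l_dvd_q pi pi_x pi_y rho rho_surj => [|[|p]] //.
move=> l_prime l_odd l_dvd_q pi pi_x pi_y rho rho_surj.
have [k [kab kE]] := knot_rep_aff _ _ _ pi rho l_odd pi_x pi_y rho_surj.
rewrite (twisted_alexander_refl _ _ _ _ k) //= -/t.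
rewrite [t ^+ 2 ^+ _]exprAC; apply: alexander_quotient.
- exact: alexander_torus_mul.
- by rewrite -[t]expr1 tvar_expr_neq1.
- by rewrite -exprM tvar_expr_neq1.
Qed.
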